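(* For each integer $k\ge3$, there are infinitely many connected unweighted graphs with maximum degree $k$ containing a sedentary pair state. In particular, there are infinitely many unweighted trees with maximum degree three containing a sedentary pair state.
   Context: For a graph with adjacency matrix $A$ and transition matrix $U(t)=\exp(itA)$, a unit vector $\mathbf u$ is sedentary if there is a constant $0<C\le1$ with $\inf_{t>0}|\mathbf u^*U(t)\mathbf u|\ge C$. A pair state is $\frac1{\sqrt2}(\mathbf e_a-\mathbf e_b)$ with $a\ne b$ vertices. Unweighted means all edge weights are $1$. *)

(* Defs.v *)
From HB Require Import structures.
From mathcomp Require Import all_boot all_order all_algebra.
From mathcomp Require Import complex.
From mathcomp Require Import all_classical all_reals all_analysis.

Set Implicit Arguments.
Unset Strict Implicit.
Unset Printing Implicit Defensive.

Import Order.TTheory GRing.Theory Num.Theory.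
Import numFieldNormedType.Exports.

Local Open Scope classical_set_scope.
Local Open Scope ring_scope.
Local Open Scope complex_scope.

(* Finite simple graphs; up to isomorphism the vertex set is 'I_n. *)
Record sgraph := SGraph {
  nverts : nat;
  adj : rel 'I_nverts;
  adj_sym : symmetric adj;
  adj_irrefl : irreflexive adj
}.

Definition isomorphic (G H : sgraph) : Prop :=
  exists2 f : 'I_(nverts G) -> 'I_(nverts H),
    bijective f & {mono f : x y / @adj G x y >-> @adj H x y}.

(* "Infinitely many graphs" is counted up to isomorphism. *)
Definition infinitely_many_graphs (P : sgraph -> Prop) : Prop :=
  exists2 G : nat -> sgraph,
    (forall m, P (G m)) & (forall m n, m <> n -> ~ isomorphic (G m) (G n)).

Definition connected_graph (G : sgraph) : Prop :=
  (0 < nverts G)%N /\ forall x y : 'I_(nverts G), connect (@adj G) x y.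

(* A duplicate-free adj-cycle of length 2 is just an edge, traversed twice. *)
Definition acyclic (G : sgraph) : Prop :=
  forall c : seq 'I_(nverts G), ucycle (@adj G) c -> (size c < 3)%N.

Definition is_tree (G : sgraph) : Prop := connected_graph G /\ acyclic G.

Definition degree (G : sgraph) (x : 'I_(nverts G)) : nat :=
  #|[set y | adj x y]%SET|.

Definition max_degree (G : sgraph) : nat :=
  (\max_(x < nverts G) degree x)%N.

(* The limit is taken in the normed space of n x n matrices over C. *)
Definition expmx (C : numFieldType) (n : nat) (M : 'M[C]_n) : 'M[C]_n :=
  limn (series (fun k : nat => (k`!%:R)^-1 *: M ^+ k)).

Section QuantumWalk.
Variable R : realType.

Definition adjmx (G : sgraph) : 'M[R[i]]_(nverts G) :=
  \matrix_(x, y) (adj x y)%:R.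

Definition transition (G : sgraph) (t : R) : 'M[R[i]]_(nverts G) :=
  expmx ((0 +i* t) *: adjmx G).

Definition ctransp (m n : nat) (M : 'M[R[i]]_(m, n)) : 'M[R[i]]_(n, m) :=
  map_mx (@conjc R) M^T.

Definition unit_vector (n : nat) (u : 'cV[R[i]]_n) : Prop :=
  ctransp u *m u = 1%:M.

(* The real-valued modulus of u^* U(t) u, a 1 x 1 matrix. *)
Definition fidelity_amplitude (G : sgraph) (u : 'cV[R[i]]_(nverts G)) (t : R)
    : R :=
  Normc.normc ((ctransp u *m transition G t *m u) 0 0).

Definition sedentary (G : sgraph) (u : 'cV[R[i]]_(nverts G)) : Prop :=
  unit_vector u /\
  exists C : R, 0 < C <= 1 /\
    C <= inf [set fidelity_amplitude u t | t in [set t : R | 0 < t]].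

Definition pair_state (n : nat) (a b : 'I_n) : 'cV[R[i]]_n :=
  ((Num.sqrt 2 : R)^-1)%:C *: (delta_mx a 0 - delta_mx b 0).

Definition has_sedentary_pair_state (G : sgraph) : Prop :=
  exists a b : 'I_(nverts G), a != b /\ sedentary (pair_state a b).

End QuantumWalk.

(* Main.v *)
(** If two vertices a and b have the same neighbours, then e_a - e_b lies in the
    kernel of A, so U(t) fixes it and the fidelity is constantly 1.  The broom
    obtained from the star K_(1,k) by prolonging one edge into a path has twin
    leaves as soon as k >= 3; it is a tree of maximum degree k, and the length of
    the path is arbitrary. *)
Require Import Defs.
From mathcomp Require Import all_boot all_order all_algebra complex zify.
From mathcomp Require Import all_classical all_reals all_analysis.

Set Implicit Arguments.
Unset Strict Implicit.
Unset Printing Implicit Defensive.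

Import Order.TTheory GRing.Theory Num.Theory numFieldNormedType.Exports.

Local Open Scope classical_set_scope.
Local Open Scope ring_scope.
Local Open Scope complex_scope.

(** * Entrywise convergence of matrix sequences *)

Lemma cvg_mx_coord (C : numFieldType) (m n : nat) (F : nat -> 'M[C]_(m, n))
    (L : 'M[C]_(m, n)) :
  (forall i j, F k i j @[k --> \oo] --> L i j) -> F k @[k --> \oo] --> L.
Proof.
move=> FL A [P LP PA].
(* [A] contains a product of entry neighbourhoods [P i j]; as there are finitely many entries, their
   eventual conditions hold simultaneously. *)
have nearP : \forall k \near \oo, forall i j, P i j (F k i j).
  apply: filter_forall => i; apply: filter_forall => j.
  by apply: FL; exact: LP.
by apply: filterS nearP => k Pk; exact: PA.
Qed.

Lemma cvg_mulmxr (C : numFieldType) (m n p : nat) (F : nat -> 'M[C]_(m, n))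
    (L : 'M[C]_(m, n)) (B : 'M[C]_(n, p)) :
  F k @[k --> \oo] --> L -> F k *m B @[k --> \oo] --> L *m B.
Proof.
move=> FL; apply: cvg_mx_coord => i j.
rewrite mxE; under eq_fun do rewrite mxE.
apply: cvg_big => [|l _]; first exact: add_continuous.
apply: cvgM; last exact: cvg_cst.
exact: (cvg_comp _ _ FL (@coord_continuous _ _ _ _ _ _)).
Qed.

(** * Complex series and convergence of the matrix exponential *)

Section ComplexSeries.
Local Notation Re := complex.Re.
Local Notation Im := complex.Im.
Variable R : realType.

Lemma normc_le_ReIm (z : R[i]) : Normc.normc z <= `|Re z| + `|Im z|.
Proof.
case: z => a b /=; rewrite -[leRHS]ger0_norm ?addr_ge0// -sqrtr_sqr.
apply: ler_wsqrtr; rewrite sqrrD !real_normK ?num_real//.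
by rewrite -addrAC lerDl mulrn_wge0// mulr_ge0.
Qed.

Lemma norm_Re_le_normc (z : R[i]) : `|Re z| <= Normc.normc z.
Proof. by case: z => a b /=; rewrite -sqrtr_sqr ler_wsqrtr// lerDl sqr_ge0. Qed.

Lemma norm_Im_le_normc (z : R[i]) : `|Im z| <= Normc.normc z.
Proof. by case: z => a b /=; rewrite -sqrtr_sqr ler_wsqrtr// lerDr sqr_ge0. Qed.

Lemma cvg_complex (u : nat -> R[i]) (l : R[i]) :
  Re (u k) @[k --> \oo] --> Re l -> Im (u k) @[k --> \oo] --> Im l ->
  (u : nat -> (R[i] : numFieldType)) k @[k --> \oo] --> (l : (R[i] : numFieldType)).
Proof.
move=> /cvgrPdist_lt ur /cvgrPdist_lt ui; apply/cvgrPdist_lt => e.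
(* The norm of [R[i]] takes values in [R[i]], so the radius is complex; its positivity forces a zero
   imaginary part. *)
case: e => e e' /=; rewrite ltcE /= => /andP[/eqP -> e0].
have e20 : 0 < e / 2 by rewrite divr_gt0.
near=> k.
rewrite -[`|_|]/((Normc.normc (l - u k))%:C) ltcR.
apply: le_lt_trans (normc_le_ReIm _) _.
rewrite [ltRHS](splitr e) !raddfB /=; apply: ltrD.
  by near: k; exact: ur.
by near: k; exact: ui.
Unshelve. all: by end_near. Qed.

Lemma Re_sum (I : Type) (s : seq I) (P : pred I) (F : I -> R[i]) :
  Re (\sum_(i <- s | P i) F i) = \sum_(i <- s | P i) Re (F i).
Proof. exact: (raddf_sum (@Re R : {additive _ -> _})). Qed.

Lemma Im_sum (I : Type) (s : seq I) (P : pred I) (F : I -> R[i]) :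
  Im (\sum_(i <- s | P i) F i) = \sum_(i <- s | P i) Im (F i).
Proof. exact: (raddf_sum (@Im R : {additive _ -> _})). Qed.

(** [Rcomplex R] is [R[i]] with the real-valued norm [normc], so this is its triangle inequality. *)
Lemma normc_sum (I : Type) (s : seq I) (P : pred I) (F : I -> R[i]) :
  Normc.normc (\sum_(i <- s | P i) F i) <=
  \sum_(i <- s | P i) Normc.normc (F i).
Proof. exact: (@ler_norm_sum R (Rcomplex R)). Qed.

Lemma normc_ge0 (z : R[i]) : 0 <= Normc.normc z.
Proof. exact: (@normr_ge0 R (Rcomplex R)). Qed.

Lemma normc_real (x : R) : Normc.normc x%:C = `|x|.
Proof. by rewrite /= expr0n addr0 sqrtr_sqr. Qed.

(** Comparison test: the real and imaginary parts are both dominated by [v], hence their series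
    converge absolutely in [R]. *)
Lemma cvg_series_complex (u : nat -> R[i]) (v : nat -> R) :
  (forall k, Normc.normc (u k) <= v k) -> cvgn (series v) ->
  exists l : R[i], (series u : nat -> (R[i] : numFieldType)) k @[k --> \oo] -->
    (l : (R[i] : numFieldType)).
Proof.
move=> uv cv.
have v0 k : 0 <= v k by exact: le_trans (normc_ge0 _) (uv k).
have cvg_part (f : nat -> R) : (forall k, `|f k| <= Normc.normc (u k)) ->
    cvgn (series f).
  move=> fu; apply: normed_cvg; apply: series_le_cvg cv => //= k.
  exact: le_trans (fu k) (uv k).
have cr := cvg_part (fun k => Re (u k)) (fun k => norm_Re_le_normc _).
have ci := cvg_part (fun k => Im (u k)) (fun k => norm_Im_le_normc _).
exists (limn (series (fun k => Re (u k))) +i* limn (series (fun k => Im (u k)))).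
apply: cvg_complex => /=.
  by rewrite /series /=; under eq_fun do rewrite Re_sum.
by rewrite /series /=; under eq_fun do rewrite Im_sum.
Qed.

(** Each further factor [M] turns an entry into a sum of [n] products, which costs a factor
    [n%:R * B]. *)
Lemma normc_expr_mx_le (n : nat) (M : 'M[R[i]]_n) (B : R) :
  (forall x y, Normc.normc (M x y) <= B) ->
  forall k x y, Normc.normc ((M ^+ k) x y) <= (n%:R * B) ^+ k.
Proof.
move=> MB; elim=> [|k IH] x y.
  rewrite !expr0 mxE.
  by case: (x == y); rewrite ?mulr1n ?mulr0n ?Normc.normc1 ?Normc.normc0.
rewrite exprSr -[_ * M]/(_ *m M) mxE; apply: le_trans (normc_sum _ _ _) _.
have -> : (n%:R * B) ^+ k.+1 = \sum_(z < n) (n%:R * B) ^+ k * B.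
  by rewrite sumr_const card_ord -[RHS]mulr_natl exprSr mulrCA.
apply: ler_sum => z _.
by rewrite Normc.normcM ler_pM ?normc_ge0.
Qed.

(** [limn] is meaningful only for a convergent sequence. Here every entry is dominated by the real
    exponential series at [n%:R * B]. *)
Lemma expmx_cvg (n : nat) (M : 'M[R[i]]_n) :
  series (fun k : nat => (k`!%:R)^-1 *: M ^+ k) k @[k --> \oo] --> expmx M.
Proof.
(* A crude uniform bound on the entries: the sum of all their moduli. *)
pose B := \sum_x \sum_y Normc.normc (M x y).
have MB x y : Normc.normc (M x y) <= B.
  rewrite /B (bigD1 x)//= (bigD1 y)//= -addrA lerDl.
  by rewrite addr_ge0// sumr_ge0// => ? _; rewrite ?sumr_ge0// => *; exact: normc_ge0.
have ent x y : exists l : R[i],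
    (series (fun k => ((k`!%:R)^-1 *: M ^+ k) x y) : nat -> (R[i] : numFieldType)) k
    @[k --> \oo] --> (l : (R[i] : numFieldType)).
  apply: cvg_series_complex (is_cvg_series_exp_coeff (n%:R * B)) => k.
  rewrite mxE Normc.normcM Normc.normcV mulrC /exp_coeff /=.
  have -> : Normc.normc (k`!%:R : R[i]) = k`!%:R.
    by rewrite -(rmorph_nat (real_complex R)) normc_real ger0_norm.
  by rewrite ler_wpM2r ?invr_ge0// normc_expr_mx_le.
have [l lP] : exists l : 'I_n -> 'I_n -> R[i], forall x y,
    (series (fun k => ((k`!%:R)^-1 *: M ^+ k) x y) : nat -> (R[i] : numFieldType)) k
    @[k --> \oo] --> (l x y : (R[i] : numFieldType)).
  have /choice[l lP] : forall p : 'I_n * 'I_n, exists l : R[i],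
    (series (fun k => ((k`!%:R)^-1 *: M ^+ k) p.1 p.2) : nat -> (R[i] : numFieldType)) k
    @[k --> \oo] --> (l : (R[i] : numFieldType)) by move=> [x y]; exact: ent.
  by exists (fun x y => l (x, y)) => x y; exact: (lP (x, y)).
have h : series (fun k : nat => (k`!%:R)^-1 *: M ^+ k) k @[k --> \oo] -->
    (\matrix_(x, y) l x y : 'M[R[i] : numFieldType]_n).
  apply: cvg_mx_coord => x y; rewrite mxE; apply: cvg_trans (lP x y).
  by rewrite /series /=; under [in X in _ `=>` X]eq_fun do rewrite -summxE.
rewrite /expmx.
exact: (cvgP _ h).
Qed.

Lemma expmx_kernel (n : nat) (M : 'M[R[i]]_n) (u : 'cV[R[i]]_n) :
  M *m u = 0 -> expmx M *m u = u.
Proof.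
move=> Mu.
(* All terms of positive degree kill [u], leaving the identity. The index is [k.+1] because the
   empty partial sum is 0. *)
have partial_sum k : series (fun j : nat => (j`!%:R)^-1 *: M ^+ j) k.+1 *m u = u.
  rewrite /series /= big_nat_recl// expr0 fact0 invr1 scale1r mulmxDl mul1mx.
  rewrite mulmx_suml big1 ?addr0// => j _.
  by rewrite -scalemxAl exprSr -[_ * M]/(_ *m M) -mulmxA Mu mulmx0 scaler0.
have := cvg_mulmxr (B := u) (@expmx_cvg _ M).
move=> /cvg_lim <-; last exact: norm_hausdorff.
apply: cvg_lim; first exact: norm_hausdorff.
apply: cvg_near_cst; exists 1%N => // -[//|k] _ /=.
exact: partial_sum.
Qed.

End ComplexSeries.

(** * Pair states on twin vertices *)

Section TwinVertices.
Variable R : realType.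

Lemma ctransp_pair_state (n : nat) (a b : 'I_n) :
  ctransp (pair_state R a b) =
  ((Num.sqrt 2 : R)^-1)%:C *: (delta_mx 0 a - delta_mx 0 b).
Proof.
apply/matrixP => i j; rewrite /ctransp /pair_state !mxE rmorphM rmorphB /=.
by rewrite !conjc_nat oppr0 andbC [(j == b) && _]andbC.
Qed.

Lemma pair_state_unit (n : nat) (a b : 'I_n) :
  a != b -> unit_vector (pair_state R a b).
Proof.
move=> ab; rewrite /unit_vector ctransp_pair_state /pair_state.
rewrite -scalemxAl -scalemxAr scalerA mulmxBl !mulmxBr !mul_delta_mx_cond.
rewrite !eqxx [b == a]eq_sym (negbTE ab) !mulr1n !mulr0n subr0 sub0r opprK.
rewrite -rmorphM /= -invfM -expr2 sqr_sqrtr//.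
apply/matrixP => i j; rewrite !ord1 !mxE /= -[1 + 1]/(2%:R).
by rewrite -(rmorph_nat (real_complex R)) -rmorphM /= mulVf// pnatr_eq0.
Qed.

Lemma twin_has_sedentary_pair_state (G : sgraph) (a b : 'I_(nverts G)) :
  a != b -> (forall x, adj x a = adj x b) -> has_sedentary_pair_state R G.
Proof.
move=> ab twin; exists a, b; split => //; have uu := pair_state_unit ab.
(* The best constant, 1, is available since the fidelity is identically 1. *)
split=> //; exists 1; split; first by rewrite ltr01 lexx.
have Au : adjmx R G *m pair_state R a b = 0.
  rewrite /pair_state -scalemxAr mulmxBr -!colE.
  suff -> : col a (adjmx R G) = col b (adjmx R G) by rewrite subrr scaler0.
  by apply/matrixP => x y; rewrite !mxE twin.
have fid t : fidelity_amplitude (pair_state R a b) t = 1.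
  rewrite /fidelity_amplitude -mulmxA expmx_kernel ?uu ?mxE ?Normc.normc1//.
  by rewrite -scalemxAl Au scaler0.
suff -> : [set fidelity_amplitude (pair_state R a b) t | t in [set t : R | 0 < t]] = [set 1].
  by rewrite inf1.
apply/seteqP; split => [_ [t _ <-]|_ ->]; first by rewrite fid.
(* Any positive time shows that the value 1 is attained; time 1 is taken. *)
by exists 1; rewrite ?fid/=.
Qed.

End TwinVertices.

(** * The broom graph: tree structure and degrees *)

Section Broom.
Variables k m : nat.

(* Vertex 0 is joined to 1, ..., k; vertex k starts the path k, k+1, ..., k+m. *)
Definition broom_parent (i : nat) : nat := if (i <= k)%N then 0%N else i.-1.

(** The positivity guards exclude a loop at the root, since [broom_parent 0] is 0. *)
Definition broom_adj : rel 'I_(k + m).+1 := fun x y =>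
  ((0 < y)%N && (broom_parent y == x)) || ((0 < x)%N && (broom_parent x == y)).

Lemma broom_parent_lt (i : nat) : (0 < i)%N -> (broom_parent i < i)%N.
Proof. by rewrite /broom_parent; case: ifP => // _; case: i. Qed.

Lemma broom_adj_sym : symmetric broom_adj.
Proof. by move=> x y; rewrite /broom_adj orbC. Qed.

Lemma broom_adj_irrefl : irreflexive broom_adj.
Proof.
move=> x; rewrite /broom_adj orbb; apply/negP => /andP[/broom_parent_lt + /eqP xx].
by rewrite xx ltnn.
Qed.

Definition broom : sgraph := SGraph broom_adj_sym broom_adj_irrefl.

(** Parents have smaller labels, so the larger end of an edge is always the child. *)
Lemma broom_adj_leq_parent (x y : 'I_(k + m).+1) :
  broom_adj x y -> (y <= x)%N -> val y = broom_parent x.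
Proof.
rewrite /broom_adj => /orP[/andP[/broom_parent_lt + /eqP yx]|/andP[_ /eqP->]] //.
by rewrite yx ltnNge => /negP.
Qed.

Lemma broom_connected : connected_graph broom.
Proof.
split => // x y.
have root (z : 'I_(k + m).+1) : connect broom_adj z ord0.
  (* Strong induction on the label: passing to the parent descends to 0. *)
  have [j] := ubnP (val z); elim: j z => // j IH z; rewrite ltnS => zi.
  have [z0|z0] := posnP z; first by rewrite (_ : z = ord0) //; exact: val_inj.
  have pz := broom_parent_lt z0.
  apply: (connect_trans (connect1 _) (IH (Ordinal (ltn_trans pz (ltn_ord z))) _)).
    by rewrite /broom_adj /= z0 eqxx orbT.
  exact: leq_trans pz zi.
apply: connect_trans (root x) _; rewrite (sym_connect_sym broom_adj_sym).
exact: root.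
Qed.

(* Both cycle-neighbours of the largest vertex of a cycle are its parent. *)
Lemma broom_acyclic : acyclic broom.
Proof.
move=> c /andP[cc uc]; rewrite ltnNge; apply/negP => c3.
have [x xc xmax] : exists2 x, x \in c & forall y, y \in c -> (val y <= val x)%N.
  case: c c3 {cc uc} => // x0 c _.
  have x0c : x0 \in x0 :: c by rewrite mem_head.
  by case: (@arg_maxnP _ x0 (mem (x0 :: c)) val x0c) => x xc xm; exists x.
have [j c' rc] := rot_to xc.
have := cc; have := uc; rewrite -(rot_cycle j) -(rot_uniq j) rc.
have {c3} : (2 < size (x :: c'))%N by rewrite -rc size_rot.
have {}xmax y : y \in c' -> (val y <= val x)%N.
  by move=> yc; apply: xmax; rewrite -(mem_rot j) rc inE yc orbT.
(* Length at least 3 lets the rotated cycle be written [x, y, ..., z], where [y] and [z] are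
   separate entries, both adjacent to [x]. *)
case: c' xmax {rc} => // y c' xmax; case/lastP: c' xmax => // c' z xmax _.
rewrite /cycle rcons_path last_cons last_rcons /= => /and3P[_ yz _] /andP[/andP[xy _] zx].
have yE := broom_adj_leq_parent xy (xmax y (mem_head _ _)).
have zE : val z = broom_parent x.
  apply: broom_adj_leq_parent; first by rewrite broom_adj_sym.
  by apply: xmax; rewrite inE mem_rcons mem_head orbT.
have yzE : y = z by apply: val_inj; rewrite yE zE.
by rewrite yzE mem_rcons mem_head in yz.
Qed.

(** The right-hand side does not mention [y], so all these leaves are twins. Vertex [k] is left out
    because the path starts there. *)
Lemma broom_adj_leaf (x y : 'I_(k + m).+1) :
  (0 < y < k)%N -> broom_adj x y = (x == 0 :> nat).
Proof.
move=> /andP[y0 yk]; rewrite /broom_adj y0 /broom_parent (ltnW yk) /= eq_sym.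
case: eqP => //= x0; case: ifP => xk.
  by rewrite [_ == _]ltn_eqF// andbF.
by apply/negbTE; move: xk yk; lia.
Qed.

Lemma broom_degree0 : (0 < k)%N -> degree (ord0 : 'I_(nverts broom)) = k.
Proof.
move=> k0.
rewrite -[RHS](card_ord k) -cardsT.
have leafK (j : 'I_k) : (inord j.+1 : 'I_(k + m).+1) = j.+1 :> nat.
  by rewrite inordK// ltnS (leq_trans (ltn_ord j))// leq_addr.
rewrite -(@card_imset _ _ (fun j : 'I_k => inord j.+1 : 'I_(k + m).+1)); last first.
  by move=> i j /(congr1 val); rewrite /= !leafK => -[] /val_inj.
apply: eq_card => y; rewrite inE /= /broom_adj /= orbF.
apply/andP/imsetP => [[y0 /eqP py]|[j _ ->]]; last first.
  by rewrite leafK /broom_parent ltn_ord.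
(* Were [y] beyond [k], its parent [y.-1] being 0 would give [y = 1] and [k = 0]. *)
have yk : (y.-1 < k)%N.
  by move: py y0 k0; rewrite /broom_parent; move: (nat_of_ord y) => i; case: ifP; lia.
by exists (Ordinal yk) => //; apply: ord_inj; rewrite leafK /= prednK.
Qed.

Lemma broom_degree_le2 (x : 'I_(nverts broom)) : (0 < x)%N -> (degree x <= 2)%N.
Proof.
move=> x0.
(* A nonzero vertex has one parent and at most the child [x.+1]. At the end of the path [inord x.+1]
   is a default vertex, harmless for an upper bound. *)
pose s : {set 'I_(k + m).+1} := [set inord (broom_parent x); inord x.+1]%SET.
apply: (@leq_trans #|s|); last by rewrite cards2; case: eqP.
apply/subset_leq_card/fintype.subsetP => y; rewrite !inE /= /broom_adj.
move=> /orP[/andP[y0 /eqP yx]|/andP[_ /eqP ->]]; last by rewrite inord_val eqxx.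
suff -> : x.+1 = y by rewrite inord_val eqxx orbT.
move: yx x0 y0; rewrite /broom_parent.
by move: (nat_of_ord x) (nat_of_ord y) => i j; case: ifP => _; lia.
Qed.

Lemma broom_max_degree : (2 <= k)%N -> max_degree broom = k.
Proof.
move=> k2; have deg0 := broom_degree0 (ltnW k2).
apply/eqP; rewrite eqn_leq -[X in _ && (X <= _)%N]deg0 leq_bigmax andbT.
apply/bigmax_leqP => x _.
have [x0|x0] := posnP x; last exact: leq_trans (broom_degree_le2 x0) k2.
by rewrite (_ : x = ord0) ?deg0//; exact: val_inj.
Qed.

Lemma broom_has_sedentary_pair_state (R : realType) :
  (3 <= k)%N -> has_sedentary_pair_state R broom.
Proof.
move=> k3.
have lt1 : (1 < (k + m).+1)%N by lia.
have lt2 : (2 < (k + m).+1)%N by lia.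
(* Vertices 1 and 2 are both leaves at 0 because [2 < k]. *)
apply: (@twin_has_sedentary_pair_state R broom (Ordinal lt1) (Ordinal lt2)) => // x.
by rewrite /= !broom_adj_leaf //= (ltnW k3).
Qed.

End Broom.

(** * Infinitely many brooms up to isomorphism *)

Lemma isomorphic_nverts (G H : sgraph) : isomorphic G H -> nverts G = nverts H.
Proof.
by move=> [f fbij _]; have := bij_eq_card fbij; rewrite !card_ord.
Qed.

Lemma infinitely_many_trees_sedentary (R : realType) (k : nat) : (3 <= k)%N ->
  infinitely_many_graphs (fun G : sgraph =>
    is_tree G /\ max_degree G = k /\ has_sedentary_pair_state R G).
Proof.
move=> k3; exists (broom k) => [m|m m' mm' /isomorphic_nverts /=].
  split; first by split; [exact: broom_connected|exact: broom_acyclic].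
  by split; [apply: broom_max_degree; exact: ltnW|exact: broom_has_sedentary_pair_state].
(* The vertex count [(k + m).+1] determines the path length [m]. *)
by move=> [] /addnI.
Qed.

Theorem theorem7p7 (R : realType) :
  (forall k : nat, (3 <= k)%N ->
     infinitely_many_graphs (fun G : sgraph =>
       connected_graph G /\ max_degree G = k /\
       has_sedentary_pair_state R G)) /\
  infinitely_many_graphs (fun G : sgraph =>
    is_tree G /\ max_degree G = 3%N /\ has_sedentary_pair_state R G).
Proof.
split=> [k k3|]; last exact: infinitely_many_trees_sedentary.
(* The same trees serve as the connected graphs of maximum degree [k]. *)
have [G GP Giso] := infinitely_many_trees_sedentary R k3.
by exists G => // m; have [[]] := GP m.
Qed.
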